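(* Let $A,B,C\in\mathbb{M}_n$. Then there exist three isometries $U_1,U_2,U_3\in\mathbb{M}_{3n,n}$ such that $$|A+B|^2\oplus|B+C|^2\oplus|A+C|^2=\frac13\sum_{k=1}^3U_k\left(|A+B+C|^2+|A|^2+|B|^2+|C|^2\right)U_k^*.$$
   Context: $\mathbb{M}_{m,n}$ is the space of $m\times n$ complex matrices, $\mathbb{M}_n=\mathbb{M}_{n,n}$; $|Z|^2=Z^*Z$. $\oplus$ denotes the block-diagonal direct sum. An isometry in $\mathbb{M}_{3n,n}$ is a matrix $V$ with $V^*V=I_n$. *)

(* Defs.v *)
From mathcomp Require Import all_boot all_order all_algebra.
From mathcomp Require Import reals complex.

Set Implicit Arguments.
Unset Strict Implicit.
Unset Printing Implicit Defensive.

Import Order.TTheory GRing.Theory Num.Theory.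
Local Open Scope ring_scope.
Local Open Scope sesquilinear_scope.

Definition sqabsmx (C : numClosedFieldType) (m n : nat) (Z : 'M[C]_(m, n)) :
  'M[C]_n := Z ^t* *m Z.

(* Distinct from mathcomp's unitarymx, which requires the rows, not the
   columns, to be orthonormal: V *m V ^t* = 1%:M. *)
Definition isometrymx (C : numClosedFieldType) (m n : nat) (V : 'M[C]_(m, n)) :
  Prop := V ^t* *m V = 1%:M.

Definition dsummx (C : numClosedFieldType) (m n : nat)
  (X : 'M[C]_m) (Y : 'M[C]_n) : 'M[C]_(m + n) := block_mx X 0 0 Y.

(* Main.v *)
Require Import Defs.
From mathcomp Require Import all_boot all_order all_algebra.
From mathcomp Require Import reals complex ring.

(* Write the three summands as X^2, Y^2, Z^2 with X, Y, Z Hermitian, and stack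
   X, Y, Z into a column T of size 3n x n. Then T^*T = X^2 + Y^2 + Z^2, which is
   also |A+B+C|^2 + |A|^2 + |B|^2 + |C|^2, and the polar decomposition of T
   gives an isometry V with T T^* = V (T^*T) V^*. The diagonal blocks of T T^*
   are X^2, Y^2, Z^2, and averaging over conjugation by the block-diagonal
   unitaries D_k = diag(1, w^k, w^2k), w a primitive cube root of unity, kills
   its other blocks; so U_k = D_k V works. *)

Set Implicit Arguments.
Unset Strict Implicit.
Unset Printing Implicit Defensive.

Import Order.TTheory GRing.Theory Num.Theory.
Local Open Scope ring_scope.
Local Open Scope sesquilinear_scope.

Lemma trmxC_mul (F : numClosedFieldType) m n p
  (X : 'M[F]_(m, n)) (Y : 'M[F]_(n, p)) :
  (X *m Y) ^t* = Y ^t* *m X ^t*.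
Proof. by rewrite trmx_mul map_mxM. Qed.

Lemma trmxCZ (F : numClosedFieldType) m n (a : F) (X : 'M[F]_(m, n)) :
  (a *: X) ^t* = a^* *: X ^t*.
Proof. by rewrite linearZ map_mxZ. Qed.

Lemma trmxC_diag_real (F : numClosedFieldType) n (d : 'rV[F]_n) :
  d \is a realmx -> (diag_mx d) ^t* = diag_mx d.
Proof. by move=> /realmxC d_real; rewrite tr_diag_mx map_diag_mx d_real. Qed.

Lemma mulmx_trmxCE (F : numClosedFieldType) m n p
  (X : 'M[F]_(m, n)) (Y : 'M[F]_(p, n)) i j :
  (X *m Y ^t*) i j = dotmx (row i X) (row j Y).
Proof. by rewrite dotmxE !mxE; apply: eq_bigr => k _; rewrite !mxE. Qed.

(* The orthogonal rows are normalized once the zero rows have been replaced,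
   one at a time, by nonzero vectors orthogonal to all the others, which
   exist because a zero row makes the rank less than [m <= n]. *)
Lemma orthogonal_rows_factor (F : numClosedFieldType) m n (M : 'M[F]_(m, n)) :
  (m <= n)%N -> is_diag_mx (M *m M ^t*) ->
  exists d : 'rV[F]_m, exists2 V : 'M[F]_(m, n),
    V \is unitarymx & d \is a realmx /\ M = diag_mx d *m V.
Proof.
move=> le_mn; have [k] := ubnP #|[set i | row i M == 0]|.
elim: k M => // k IHk M /ltnSE-leMk dM.
have [/existsP[i0 /eqP Mi0]|] := boolP [exists i, row i M == 0]; last first.
  rewrite negb_exists => /forallP Mn0.
  have G0 i : 0 < (M *m M ^t*) i i.
    by rewrite mulmx_trmxCE dotmx_is_dotmx.
  (* With no zero row, [d] collects the norms of the rows, and dividing by them makes the orthogonal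
     rows orthonormal. *)
  have [d [dr d0 dd]] : exists d : 'rV[F]_m, [/\ d \is a realmx,
      forall i, d 0 i != 0 & forall i, (M *m M ^t*) i i = d 0 i * d 0 i].
    exists (\row_i sqrtC ((M *m M ^t*) i i)); split=> [|i|i].
    - by apply/mxOverP => i j; rewrite mxE ger0_real // sqrtC_ge0 ltW.
    - by rewrite mxE sqrtC_eq0 gt_eqF.
    - by rewrite [in RHS]mxE -expr2 sqrtCK.
  pose e := \row_i (d 0 i)^-1.
  have er : e \is a realmx.
    by apply/mxOverP => i j; rewrite mxE realV; apply: (mxOverP dr).
  exists d, (diag_mx e *m M); last first.
    split=> //; rewrite mulmxA mulmx_diag; apply/matrixP => i j.
    by rewrite mul_diag_mx !mxE divff ?mul1r.
  apply/unitarymxP; rewrite trmxC_mul trmxC_diag_real // !mulmxA.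
  rewrite -(mulmxA _ M); move/is_diag_mxP: dM => dM.
  apply/matrixP => i j; rewrite mul_mx_diag mul_diag_mx.
  rewrite mxE [X in X * _]mxE [e 0 i]mxE [e 0 j]mxE [RHS]mxE.
  have [<-|ij] := eqVneq i j; last by rewrite dM ?mulr0 ?mul0r.
  by rewrite dd mulrA mulVf // mul1r divff.
have [u u0 uM] : exists2 u : 'rV[F]_n, u != 0 & u *m M ^t* = 0.
  have /rowV0Pn[u uK u0] : kermx (M ^t*) != 0.
    rewrite kermx_eq0; apply/negP.
    rewrite /row_free mxrank_map mxrank_tr => /eqP rM.
    have Mfree : row_free M by rewrite /row_free eqn_leq rank_leq_row rM.
    have : delta_mx (0 : 'I_1) i0 *m M == 0 by rewrite -rowE Mi0.
    rewrite mulmx_free_eq0 // => /eqP/matrixP/(_ 0 i0)/eqP.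
    by rewrite !mxE !eqxx oner_eq0.
  by exists u => //; apply/sub_kermxP.
have Mu : M *m u ^t* = 0 by rewrite -[M]trmxCK -trmxC_mul uM trmx0 map_mx0.
have uMi i : dotmx u (row i M) = 0 by rewrite -[u](row_id 0) -mulmx_trmxCE uM mxE.
have Miu i : dotmx (row i M) u = 0 by rewrite -[u](row_id 0) -mulmx_trmxCE Mu mxE.
pose M' := \matrix_i (if i == i0 then u else row i M).
have rowM' i : row i M' = if i == i0 then u else row i M by rewrite rowK.
have [||d [V Vu [dr M'V]]] := IHk M'.
- apply: leq_trans leMk; apply: proper_card; apply/properP; split.
    apply/subsetP => i; rewrite !inE rowM'; case: (i == i0) => //.
    by rewrite (negPf u0).
  by exists i0; rewrite !inE ?Mi0 // rowM' eqxx.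
- apply/is_diag_mxP => i j ij; rewrite mulmx_trmxCE !rowM'.
  case: eqVneq => [ii0|_]; case: eqVneq => [ji0|_] //.
    by rewrite ii0 ji0 eqxx in ij.
  by rewrite -mulmx_trmxCE (is_diag_mxP dM).
(* A zero coefficient at [i0] erases the auxiliary row [u] and restores the zero row of [M], while
   [V] stays unitary. *)
pose e := \row_i (if i == i0 then 0 else d 0 i).
exists e, V => //; split.
  by apply/mxOverP => i j; rewrite mxE; case: ifP => // _; apply: (mxOverP dr).
apply/row_matrixP => i; have := rowM' i.
rewrite M'V !row_mul !row_diag_mx [e 0 i]mxE.
by case: eqVneq => [->|_ ->//]; rewrite scale0r mul0mx Mi0.
Qed.

(** If a unitary [P] diagonalizes M M^*, the rows of P M are orthogonal, so P M = d V with d real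
    diagonal. Then M = (P^* d P)(P^* V). *)
Lemma polar_decomposition (F : numClosedFieldType) m n (M : 'M[F]_(m, n)) :
  (m <= n)%N -> exists H : 'M[F]_m, exists2 W : 'M[F]_(m, n),
    W \is unitarymx & H ^t* = H /\ M = H *m W.
Proof.
move=> le_mn; set P := spectralmx (M *m M ^t*).
have Pu : P \is unitarymx := spectral_unitarymx _.
have /orthomx_spectralP : M *m M ^t* \is normalmx.
  by apply/normalmxP; rewrite trmxC_mul trmxCK.
rewrite -/P; set D := diag_mx _ => MME.
have [|d [V Vu [dr PM]]] := @orthogonal_rows_factor _ _ _ (P *m M) le_mn.
  rewrite trmxC_mul mulmxA -(mulmxA P) MME invmx_unitary // !mulmxA.
  by rewrite (unitarymxP Pu) mul1mx mulmxtVK // diag_mx_is_diag.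
exists (P ^t* *m diag_mx d *m P), (P ^t* *m V).
  by rewrite mul_unitarymx // trmxC_unitary.
split; first by rewrite !trmxC_mul trmxCK trmxC_diag_real // mulmxA.
rewrite mulmxA mulmxtVK // -mulmxA -PM mulmxA -(invmx_unitary Pu).
by rewrite mulVmx ?unitarymx_unit // mul1mx.
Qed.

(** From M^* = H W one gets M^* M = H W W^* H, where the unitary factor cancels. *)
Lemma sqabsmx_hermitian_sqrt (F : numClosedFieldType) n (M : 'M[F]_n) :
  exists2 H : 'M[F]_n, H ^t* = H & sqabsmx M = H *m H.
Proof.
have [H [W Wu [HH MHW]]] := polar_decomposition (M ^t*) (leqnn n).
exists H => //; rewrite /sqabsmx -{2}[M]trmxCK MHW trmxC_mul HH mulmxA.
by rewrite mulmxtVK.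
Qed.

Lemma expr3_eq1 (R : comNzRingType) (w : R) : 1 + w + w ^+ 2 = 0 -> w ^+ 3 = 1.
Proof.
move=> w0; apply/eqP; rewrite -subr_eq0; apply/eqP.
by transitivity ((w - 1) * (1 + w + w ^+ 2)); [ring | rewrite w0 mulr0].
Qed.

Lemma exists_primitive_cube_root (F : numClosedFieldType) :
  exists2 w : F, 1 + w + w ^+ 2 = 0 & w^* = w ^+ 2.
Proof.
(* The constant coefficients -1 encode the equation w^2 = -1 - w. *)
have [w] := @solve_monicpoly F 2%N (fun _ => -1) isT.
rewrite big_ord_recl big_ord1 /= expr0 expr1 => w2.
have w0 : 1 + w + w ^+ 2 = 0 by rewrite w2; ring.
exists w => //; have w3 := expr3_eq1 w0.
(* Since |w| = 1, w w^* = 1 = w w^2, and w cancels. *)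
have /eqP : `|w| ^+ 3 = 1 by rewrite -normrX w3 normr1.
rewrite pexpr_eq1 // => /eqP w1.
have wn0 : w != 0 by rewrite -normr_eq0 w1 oner_eq0.
by apply: (mulfI wn0); rewrite -normCK w1 expr1n -exprS w3.
Qed.

Lemma mulmx_col3_trmxC (F : numClosedFieldType) m n (X Y Z : 'M[F]_(m, n)) :
  col_mx X (col_mx Y Z) *m (col_mx X (col_mx Y Z)) ^t* =
  block_mx (X *m X ^t*) (row_mx (X *m Y ^t*) (X *m Z ^t*))
    (col_mx (Y *m X ^t*) (Z *m X ^t*))
    (block_mx (Y *m Y ^t*) (Y *m Z ^t*) (Z *m Y ^t*) (Z *m Z ^t*)).
Proof.
rewrite !tr_col_mx !map_row_mx mul_col_row mul_col_row.
by rewrite mul_mx_row mul_col_mx.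
Qed.

(** In the k-th summand, block (i, j) carries the factor w^((i - j) k). Summed over k this gives 3
    on the diagonal and 1 + w + w^2 = 0 elsewhere. *)
Lemma pinching3 (F : numClosedFieldType) m n (w : F) (X Y Z : 'M[F]_(m, n)) :
  1 + w + w ^+ 2 = 0 -> w^* = w ^+ 2 ->
  let T (k : nat) := col_mx X (col_mx (w ^+ k *: Y) (w ^+ (2 * k) *: Z)) in
  \sum_(k < 3) T k *m (T k) ^t* =
    3%:R *: dsummx (X *m X ^t*) (dsummx (Y *m Y ^t*) (Z *m Z ^t*)).
Proof.
move=> w0 wc T; have w3 := expr3_eq1 w0.
(* Reducing exponents modulo 3 leaves only the two orderings [wcw] and [wwc] of the vanishing
   sum. *)
have wmod i : w ^+ i = nth 0 [:: 1; w; w^*] (i %% 3).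
  rewrite -(expr_mod i w3); have := ltn_pmod i (isT : 0 < 3)%N.
  by case: (i %% 3)%N => [|[|[|]]].
have wcw : 1 + (w + w^*) = 0 by rewrite wc addrA.
have wwc : 1 + (w^* + w) = 0 by rewrite [w^* + w]addrC.
rewrite !big_ord_recl big_ord0 addr0 !mulmx_col3_trmxC !trmxCZ.
rewrite !rmorphXn /= !wc !(add_block_mx, add_row_mx, add_col_mx).
rewrite /dsummx !scale_block_mx -!scalemxAl -!scalemxAr !scalerA -?exprM -?exprD.
rewrite -!scalerDl !wmod /= /bump /=.
rewrite wcw wwc !scale0r !scaler0 row_mx0 col_mx0.
have -> : 3%:R = 1 + (1 + 1) :> F by ring.
by rewrite !scalerDl !scale1r.
Qed.

(** After expansion, both sides contain each square twice and each ordered cross term once. *)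
Lemma sqabsmx_pairwise_sum (F : numClosedFieldType) m n (A B C : 'M[F]_(m, n)) :
  sqabsmx (A + B + C) + sqabsmx A + sqabsmx B + sqabsmx C =
  sqabsmx (A + B) + sqabsmx (B + C) + sqabsmx (A + C).
Proof.
rewrite /sqabsmx !(raddfD, map_mxD, mulmxDr) /= !mulmxDl.
by apply/matrixP => i j; rewrite !mxE; ring.
Qed.

Theorem theorem1p38 (R : realType) (n : nat) (A B C : 'M[R[i]]_n) :
  exists U : 'I_3 -> 'M[R[i]]_(n + (n + n), n),
    (forall k : 'I_3, isometrymx (U k)) /\
    dsummx (sqabsmx (A + B)) (dsummx (sqabsmx (B + C)) (sqabsmx (A + C))) =
      (3%:R)^-1 *: \sum_(k < 3)
        (U k *m (sqabsmx (A + B + C) + sqabsmx A + sqabsmx B + sqabsmx C)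
             *m (U k) ^t*).
Proof.
rewrite sqabsmx_pairwise_sum.
have [X XH ->] := sqabsmx_hermitian_sqrt (A + B).
have [Y YH ->] := sqabsmx_hermitian_sqrt (B + C).
have [Z ZH ->] := sqabsmx_hermitian_sqrt (A + C).
have [w w0 wc] := exists_primitive_cube_root R[i].
pose T := col_mx X (col_mx Y Z).
(* The decomposition is for wide matrices, hence the adjoint of the tall [T]. The rows of [W] are
   orthonormal, so [W ^t*] is the isometry V. *)
have [H [W Wu [HH TE]]] := polar_decomposition (T ^t*) (leq_addr (n + n) n).
have TW : T = W ^t* *m H by rewrite -[T]trmxCK TE trmxC_mul HH.
have SE : X *m X + Y *m Y + Z *m Z = H *m H.
  transitivity (T ^t* *m T); last by rewrite TE TW mulmxA mulmxtVK.
  by rewrite /T !tr_col_mx !map_row_mx !mul_row_col XH YH ZH addrA.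
pose D (k : nat) : 'M[R[i]]_(n + (n + n)) :=
  block_mx 1%:M 0 0 (block_mx (w ^+ k)%:M 0 0 (w ^+ (2 * k))%:M).
have DD k : (D k) ^t* *m D k = 1%:M.
  rewrite /D !tr_block_mx !map_block_mx !trmx0 !tr_scalar_mx.
  rewrite !map_mx0 !map_scalar_mx /=.
  rewrite !mulmx_block !(mul0mx, mulmx0, addr0, add0r) -!scalar_mxM.
  rewrite rmorph1 mulr1 !rmorphXn /= wc -!exprMn -exprSr (expr3_eq1 w0) !expr1n.
  by rewrite -!scalar_mx_block.
have DT k : D k *m T = col_mx X (col_mx (w ^+ k *: Y) (w ^+ (2 * k) *: Z)).
  by rewrite !mul_block_col !mul0mx !mul_scalar_mx !(addr0, add0r) scale1r.
exists (fun k => D k *m W ^t*); split.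
  move=> k; rewrite /isometrymx trmxC_mul trmxCK mulmxA -(mulmxA W) DD mulmx1.
  exact/unitarymxP.
have := pinching3 X Y Z w0 wc; rewrite /= XH YH ZH => P.
apply: (scalerI (_ : 3%:R != 0)); first by rewrite pnatr_eq0.
rewrite -P scalerA divff ?pnatr_eq0 // scale1r; apply: eq_bigr => k _.
(* Both sides equal D_k W^* H H W D_k^*. *)
by rewrite -DT TW SE !trmxC_mul trmxCK HH !mulmxA.
Qed.
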